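(* Let $\Theta'=\{(r',s')\in[0,1]^2 : 0<r'+s'\leqslant 1\}$ and let $(r',s')\in\Theta'$. (B1) There exist $\epsilon_1,\epsilon_2\in(0,1)$ (not depending on $(r',s')$) such that the probability of draw in the bond percolation game with parameters $r',s'$ equals $0$ whenever $r'\leqslant\epsilon_1$, $s'\leqslant\epsilon_2$ and $$\frac{3(2s'-s'^{2})^{2}}{2}+\frac{8(2s'-s'^{2})r'}{1-s'}+\frac{11r'^{2}}{2(1-s')^{2}}\geqslant\frac{2r'}{1-s'}+\frac{9(2s'-s'^{2})^{3}}{2}+\frac{16(2s'-s'^{2})^{2}r'}{1-s'}+\frac{43(2s'-s'^{2})r'^{2}}{2(1-s')^{2}}+\frac{5r'^{3}}{(1-s')^{3}}.$$ (B2) If $s'=0$ and $r'>0.157175$, then the probability of draw in the bond percolation game with parameters $r',s'$ equals $0$. (B3) If $r'=s'\geqslant 0.10883$, then the probability of draw in the bond percolation game with parameters $r',s'$ equals $0$.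
   Context: Bond percolation game with parameters $(r',s')$. Consider the directed graph with vertex set $\mathbb{Z}^2$ and directed edges from each $(x,y)$ to $(x+1,y)$ and to $(x,y+1)$. Each directed edge is independently labeled trap with probability $r'$, target with probability $s'$, and open with probability $1-r'-s'$. The labels are realized before the game and known to both players. A token is placed at an initial vertex and two players alternately move; a move takes the token from its current vertex $(x,y)$ to $(x+1,y)$ or $(x,y+1)$ along the corresponding directed edge. A player who moves the token along a target edge wins immediately; a player who moves it along a trap edge loses immediately; if the edge is open, the opponent moves next. The game results in a draw if, under optimal play, it continues forever, i.e. neither player has a strategy guaranteeing a win in finitely many moves. The probability of draw (over the random labels) does not depend on the initial vertex. *)

(* Defs.v *)
From HB Require Import structures.
From mathcomp Require Import all_boot all_order all_algebra.
From mathcomp Require Import all_classical all_reals all_analysis.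

Set Implicit Arguments.
Unset Strict Implicit.
Unset Printing Implicit Defensive.

Import Order.TTheory GRing.Theory Num.Theory.

Local Open Scope classical_set_scope.
Local Open Scope ring_scope.

Definition vertex : Type := (int * int)%type.

(* [false] is the step (x, y) -> (x + 1, y), [true] is (x, y) -> (x, y + 1). *)
Definition dir : Type := bool.

Definition step (v : vertex) (a : dir) : vertex :=
  if a then (v.1, v.2 + 1) else (v.1 + 1, v.2).

(* A directed edge is given by its source and its direction. *)
Definition edge : Type := ((int * int) * bool)%type.

Inductive label : Type := Trap | Target | Open.

(* The next move as a function of all the moves made so far, oldest first. *)
Definition strategy : Type := seq dir -> dir.

(* [First] makes the moves number 0, 2, 4, ... and [Second] the others. *)
Inductive player : Type := First | Second.

Definition opponent (p : player) : player :=
  if p is First then Second else First.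

Definition mover (n : nat) : player := if odd n then Second else First.

Section Game.

Variables (lab : edge -> label) (v : vertex) (strat : player -> strategy).

(* The moves are continued past the end of the game; [wins_at] below only
   takes into account the first edge that is not open. *)
Fixpoint moves (n : nat) : seq dir :=
  if n is m.+1 then rcons (moves m) (strat (mover m) (moves m)) else [::].

Definition position (n : nat) : vertex := foldl step v (moves n).

Definition played_edge (n : nat) : edge :=
  (position n, strat (mover n) (moves n)).

Definition wins_at (p : player) (n : nat) : Prop :=
  (forall m : nat, (m < n)%N -> lab (played_edge m) = Open) /\
  ((mover n = p /\ lab (played_edge n) = Target) \/
   (mover n = opponent p /\ lab (played_edge n) = Trap)).

End Game.

Definition has_winning_strategy (lab : edge -> label) (v : vertex)
    (p : player) : Prop :=
  exists sigma : strategy, forall strat : player -> strategy,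
    strat p = sigma -> exists n : nat, wins_at lab v strat p n.

Definition draw (lab : edge -> label) (v : vertex) : Prop :=
  forall p : player, ~ has_winning_strategy lab v p.

Section RandomLabels.
Context {d : measure_display} {T : measurableType d} {R : realType}.
Variable P : probability T R.

Definition mutually_independent (L : edge -> T -> label) : Prop :=
  forall (J : seq edge) (A : edge -> set label), uniq J ->
    P (\bigcap_(e in [set` J]) (L e @^-1` A e)) =
    (\prod_(e <- J) P (L e @^-1` A e))%E.

Record bond_labels (r s : R) (L : edge -> T -> label) : Prop := BondLabels {
  bond_measurable : forall (e : edge) (A : set label),
    measurable (L e @^-1` A);
  bond_independent : mutually_independent L;
  bond_trap : forall e : edge, P (L e @^-1` [set Trap]) = r%:E;
  bond_target : forall e : edge, P (L e @^-1` [set Target]) = s%:E;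
  bond_open : forall e : edge, P (L e @^-1` [set Open]) = (1 - r - s)%:E }.

Definition draw_probability (L : edge -> T -> label) (v : vertex) : \bar R :=
  P [set w | draw (fun e => L e w) v].

End RandomLabels.

(* The draw probability depends only on the law of the labels, so it is said to
   vanish when it does so for every probability space carrying labels with that
   law and for every initial vertex. *)
Definition draw_probability_eq0 (R : realType) (r s : R) : Prop :=
  forall (d : measure_display) (T : measurableType d) (P : probability T R)
         (L : edge -> T -> label) (v : vertex),
    bond_labels P r s L -> draw_probability P L v = 0%E.

Definition Theta' (R : realType) : set (R * R) :=
  [set rs | [/\ 0 <= rs.1 <= 1, 0 <= rs.2 <= 1 & 0 < rs.1 + rs.2 <= 1]].

(* Main.v *)
From Stdlib Require Import BinInt.
Require Import Defs.
From HB Require Import structures.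
From mathcomp Require Import all_boot all_order all_algebra.
From mathcomp Require Import all_classical all_reals all_analysis.
From mathcomp Require Import ring lra ssrZ zify.

Set Implicit Arguments.
Unset Strict Implicit.
Unset Printing Implicit Defensive.

Import Order.TTheory GRing.Theory Num.Theory.

Local Open Scope classical_set_scope.
Local Open Scope ring_scope.

(* Stopping the game after [n] moves gives every vertex a value (win, loss or
   undecided for the player to move), and a vertex is a draw iff it is undecided
   for all [n].  The values along an antidiagonal are computed from those along
   the next antidiagonal and from fresh independent labels, so that their law is
   that of a probabilistic cellular automaton started from "undecided"
   everywhere; it is invariant under translation.  We exhibit weights of the
   windows of three neighbouring values whose expectation decreases, under one
   step of the automaton, by at least a constant times the probability of being
   undecided.  A finite check over the windows of four values is enough, because
   the expectation of a function of three values does not depend on where they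
   are read.  Since the weights are bounded, the probability of being undecided
   is summable in [n], hence tends to 0.

   The weights were found by linear programming.  They are written
   [f x + f (rev x)] so that [f] is read on the first three and [f \o rev] on the
   last three of the four values.  In (B1) the inequality forces [r <= 7/2 s^2]
   for small [r] and [s]; there the weights are a quadratic polynomial in [s],
   whose constant term is conserved by the automaton with [r = s = 0]. *)

(** * Truncated games *)

Definition flip (a : label) : label :=
  match a with Trap => Target | Target => Trap | Open => Open end.

(** An open edge hands the move to the opponent, so it is worth the opposite of the value of its
    endpoint. *)
Definition through (l a : label) : label := if l is Open then flip a else l.

(** The maximum for the order [Trap] < [Open] < [Target]. *)
Definition best (a b : label) : label :=
  match a, b with
  | Target, _ | _, Target => Target
  | Trap, Trap => Trap
  | _, _ => Open
  end.

(* The value at [v] of the game stopped after [n] moves, encoded as the label of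
   an edge that is worth as much to the player who moves along it. *)
Fixpoint value (lab : edge -> label) (n : nat) (v : vertex) : label :=
  if n is m.+1 then
    best (through (lab (v, true)) (value lab m (step v true)))
         (through (lab (v, false)) (value lab m (step v false)))
  else Open.

Section GameValue.
Variable lab : edge -> label.

Definition option_value (n : nat) (v : vertex) (a : dir) : label :=
  through (lab (v, a)) (value lab n (step v a)).

Lemma valueS n v :
  value lab n.+1 v = best (option_value n v true) (option_value n v false).
Proof. by []. Qed.

Lemma bestTargetP a b : best a b = Target <-> a = Target \/ b = Target.
Proof. by case: a; case: b => /=; split => //; intuition. Qed.

Lemma bestTrapP a b : best a b = Trap <-> a = Trap /\ b = Trap.
Proof. by case: a; case: b => /=; split => //; intuition. Qed.

Lemma throughTargetP l a :
  through l a = Target <-> l = Target \/ (l = Open /\ a = Trap).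
Proof. by case: l; case: a => /=; split => //; intuition. Qed.

Lemma throughTrapP l a :
  through l a = Trap <-> l = Trap \/ (l = Open /\ a = Target).
Proof. by case: l; case: a => /=; split => //; intuition. Qed.

(** The options that decide the value are themselves decided, so by induction they survive one more
    move. *)
Lemma valueS_eq n v : value lab n v <> Open -> value lab n.+1 v = value lab n v.
Proof.
elim: n v => [|n IH] v; first by [].
rewrite (valueS n.+1) (valueS n).
have opt a : option_value n v a <> Open ->
    option_value n.+1 v a = option_value n v a.
  rewrite /option_value; case: (lab _) => // vn.
  by rewrite IH // => E; rewrite E in vn.
move: (opt true) (opt false).
case: (option_value n v true) => ot; case: (option_value n v false) => of_ //= _;
  try (rewrite ot; last by []); try (rewrite of_; last by []); rewrite //.
by case: (option_value n.+1 v true).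
Qed.

Lemma value_mono m n v :
  (m <= n)%N -> value lab m v <> Open -> value lab n v = value lab m v.
Proof.
move=> le_mn vm; rewrite -(subnKC le_mn); elim: (n - m)%N => [|j IH].
  by rewrite addn0.
by rewrite addnS valueS_eq IH.
Qed.

Definition best_dir (n : nat) (v : vertex) : dir :=
  if option_value n v true is Target then true else false.

Lemma best_dirP n v :
  value lab n.+1 v = Target -> option_value n v (best_dir n v) = Target.
Proof.
rewrite valueS => /bestTargetP; rewrite /best_dir.
by case E: (option_value n v true) => // -[].
Qed.

Lemma positionS v strat n :
  position v strat n.+1 =
  step (position v strat n) (strat (mover n) (moves strat n)).
Proof. by rewrite /position /= foldl_rcons. Qed.

Lemma size_moves strat n : size (moves strat n) = n.
Proof. by elim: n => //= n IH; rewrite size_rcons IH. Qed.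

Lemma moverS n : mover n.+1 = opponent (mover n).
Proof. by rewrite /mover /=; case: (odd n). Qed.

Lemma opponentK p : opponent (opponent p) = p.
Proof. by case: p. Qed.

Lemma opponent_neq p : opponent p <> p.
Proof. by case: p. Qed.

(** After [h], [n - size h] moves remain; [.-1] discounts the one about to be made, since
    [option_value] counts the moves after it. *)
Definition greedy (n : nat) (v : vertex) : strategy :=
  fun h => best_dir (n - size h).-1 (foldl step v h).

(** Induction on the number [m] of moves left: [p] keeps the value [Target] on its own turns and
    [Trap] on the other turns. The case [m = 0] cannot occur, as all values are then [Open]. *)
Lemma greedy_wins n v p strat : strat p = greedy n v ->
  forall m j, (m + j)%N = n ->
  (forall i, (i < j)%N -> lab (played_edge v strat i) = Open) ->
  (mover j = p /\ value lab m (position v strat j) = Target) \/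
  (mover j = opponent p /\ value lab m (position v strat j) = Trap) ->
  exists N, wins_at lab v strat p N.
Proof.
move=> stratp; elim=> [|m IH] j mj op; first by case=> -[].
have next : lab (played_edge v strat j) = Open ->
    forall i, (i < j.+1)%N -> lab (played_edge v strat i) = Open.
  move=> oj i; rewrite ltnS leq_eqVlt => /orP[/eqP -> //|]; exact: op.
have mj' : (m + j.+1)%N = n by rewrite addnS -addSn.
case=> -[mov val].
- have playedE : strat (mover j) (moves strat j) =
      best_dir m (position v strat j).
    by rewrite mov stratp /greedy size_moves -mj addnK.
  have := best_dirP val; rewrite /option_value => /throughTargetP.
  rewrite -playedE => -[lt|[lo vt]].
    by exists j; split => //; left.
  apply: (IH j.+1 mj' (next lo)); right.
  by rewrite moverS mov positionS.
- move: val; rewrite valueS => /bestTrapP[vt vf].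
  have {vt vf} : option_value m (position v strat j)
      (strat (mover j) (moves strat j)) = Trap by case: (strat _ _).
  rewrite /option_value => /throughTrapP[lt|[lo vt]].
    by exists j; split => //; right.
  apply: (IH j.+1 mj' (next lo)); left.
  by rewrite moverS mov opponentK positionS.
Qed.

Lemma draw_value n v : draw lab v -> value lab n v = Open.
Proof.
move=> dr; case E: (value lab n v) => //; exfalso.
- apply: (dr Second); exists (greedy n v) => strat sp.
  by apply: (greedy_wins sp (addn0 n)) => //; right.
- apply: (dr First); exists (greedy n v) => strat sp.
  by apply: (greedy_wins sp (addn0 n)) => //; left.
Qed.

Definition winning (v : vertex) : Prop := exists n, value lab n v = Target.
Definition losing (v : vertex) : Prop := exists n, value lab n v = Trap.

Definition safe_move (v : vertex) (a : dir) : Prop :=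
  lab (v, a) = Target \/ (lab (v, a) = Open /\ ~ winning (step v a)).

Lemma not_safe_move v a : ~ safe_move v a ->
  exists n, option_value n v a = Trap.
Proof.
rewrite /safe_move /option_value.
case: (lab (v, a)) => H; first by exists 0%N.
- by case: H; left.
- have [[n vn]|nw] := pselect (winning (step v a)).
    by exists n; rewrite /= vn.
  by case: H; right.
Qed.

Lemma option_value_mono m n v a :
  (m <= n)%N -> option_value m v a <> Open ->
  option_value n v a = option_value m v a.
Proof.
move=> le_mn; rewrite /option_value; case: (lab _) => //= vm.
by rewrite (value_mono le_mn) //; case: (value _ _ _) vm.
Qed.

(** If neither move were safe, each option would be [Trap] at some horizon, hence both at the larger
    one. *)
Lemma safe_moveP v : ~ losing v -> exists a, safe_move v a.
Proof.
move=> nl; apply: contrapT => ns.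
have [n hn] := not_safe_move (fun h => ns (ex_intro _ true h)).
have [m hm] := not_safe_move (fun h => ns (ex_intro _ false h)).
apply: nl; exists (maxn n m).+1; rewrite valueS; apply/bestTrapP; split.
  by rewrite (option_value_mono (leq_maxl n m)) hn.
by rewrite (option_value_mono (leq_maxr n m)) hm.
Qed.

Lemma not_winning_move v a : ~ winning v ->
  lab (v, a) <> Target /\ (lab (v, a) = Open -> ~ losing (step v a)).
Proof.
move=> nw.
have nopt n : option_value n v a <> Target.
  move=> ot; apply: nw; exists n.+1; rewrite valueS; apply/bestTargetP.
  by case: a ot; [left|right].
split=> [lt|lo [n vn]].
  by apply: (nopt 0%N); rewrite /option_value lt.
by apply: (nopt n); rewrite /option_value lo /= vn.
Qed.

Definition cautious (v : vertex) : strategy :=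
  fun h => `[< safe_move (foldl step v h) true >].

Lemma cautiousP v h : ~ losing (foldl step v h) ->
  safe_move (foldl step v h) (cautious v h).
Proof.
rewrite /cautious; case: asboolP => // ns /safe_moveP[[]//].
Qed.

Lemma value_draw v : (forall n, value lab n v = Open) -> draw lab v.
Proof.
move=> vO p [sigma win].
pose strat q := if pselect (q = p) then sigma else cautious v.
have stratp : strat p = sigma by rewrite /strat; case: pselect.
have strato : strat (opponent p) = cautious v.
  by rewrite /strat; case: pselect => // e; case: (opponent_neq e).
have [N [op fin]] := win strat stratp.
(* Against a cautious opponent, [p] never gets to move from a winning vertex, and the opponent never
   moves from a losing one. *)
have inv j : (j <= N)%N ->
    (mover j = p -> ~ winning (position v strat j)) /\
    (mover j = opponent p -> ~ losing (position v strat j)).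
  elim: j => [|j IH] jN.
    by split => _ -[n]; rewrite vO.
  have [IHp IHo] := IH (ltnW jN).
  have lo := op j jN.
  rewrite moverS !positionS; split => mj.
    have mo : mover j = opponent p by rewrite -mj opponentK.
    have := @cautiousP v (moves strat j) (IHo mo); rewrite -strato -mo => -[lt|[_]] //.
    by rewrite /played_edge in lo; rewrite lo in lt.
  have mp : mover j = p by rewrite -(opponentK (mover j)) mj opponentK.
  by have [_] := not_winning_move (strat (mover j) (moves strat j)) (IHp mp); apply.
have [invp invo] := inv N (leqnn N).
(* A target edge taken by [p] would start at a winning vertex, and a trap edge taken by the opponent
   would not be safe. *)
case: fin => -[mN lN].
  by have [] := not_winning_move (strat (mover N) (moves strat N)) (invp mN).
have := @cautiousP v (moves strat N) (invo mN); rewrite -strato -mN.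
by case=> [|[]]; move: lN; rewrite /played_edge => ->.
Qed.

Lemma drawP v : draw lab v <-> forall n, value lab n v = Open.
Proof. by split=> [dr n|]; [exact: draw_value|exact: value_draw]. Qed.

End GameValue.

(** * Expectations over windows *)

(** One step of the automaton: the new value number [i] reads the old values number [i] and [i.+1],
    and two labels of its own. *)
Fixpoint updates (x l : seq label) : seq label :=
  match x, l with
  | a :: (b :: _) as x', l1 :: l2 :: l' =>
      best (through l1 a) (through l2 b) :: updates x' l'
  | _, _ => [::]
  end.

Lemma size_updates k x l :
  size x = k.+1 -> size l = k.*2 -> size (updates x l) = k.
Proof.
elim: k x l => [|k IH] [|a [|b x]] // [|l1 [|l2 l]] //= [sx] [sl].
by congr _.+1; apply: (IH (b :: x) l) => //=; rewrite sx.
Qed.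

Section LabelExpectation.
Variables (R : realType) (p : label -> R).

Fixpoint label_exp (m : nat) (F : seq label -> R) : R :=
  if m is m'.+1 then
    p Target * label_exp m' (fun l => F (Target :: l))
    + p Trap * label_exp m' (fun l => F (Trap :: l))
    + p Open * label_exp m' (fun l => F (Open :: l))
  else F [::].

Lemma eq_label_exp m F G : (forall l, size l = m -> F l = G l) ->
  label_exp m F = label_exp m G.
Proof.
elim: m F G => [|m IH] F G FG /=; first exact: FG.
by congr (_ * _ + _ * _ + _ * _); apply: IH => l sl; apply: FG; rewrite /= sl.
Qed.

Lemma label_expP m a F G :
  label_exp m (fun l => a * F l + G l) = a * label_exp m F + label_exp m G.
Proof. by elim: m F G => [//|m IH] F G /=; rewrite !IH; ring. Qed.

(** The transition operator of the automaton, acting on functions of windows. *)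
Definition transfer (f : seq label -> R) (x : seq label) : R :=
  label_exp (size x).-1.*2 (fun l => f (updates x l)).

Lemma eq_transfer k f g : (forall y, size y = k -> f y = g y) ->
  forall x, size x = k.+1 -> transfer f x = transfer g x.
Proof.
move=> fg x sx; rewrite /transfer sx; apply: eq_label_exp => l sl.
by apply: fg; exact: size_updates.
Qed.

Lemma transferP a f g :
  transfer (fun x => a * f x + g x) = (fun x => a * transfer f x + transfer g x).
Proof. by apply/funext => x; rewrite /transfer label_expP. Qed.

Lemma iter_transferP n a f g : iter n transfer (fun x => a * f x + g x) =
  (fun x => a * iter n transfer f x + iter n transfer g x).
Proof. by elim: n => [//|n IH]; rewrite iterS IH transferP. Qed.

Lemma eq_iter_transfer n k f g : (forall y, size y = k -> f y = g y) ->
  forall x, size x = (n + k)%N -> iter n transfer f x = iter n transfer g x.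
Proof.
move=> fg; elim: n => [|n IH] x; first exact: fg.
rewrite addSn !iterS; exact: eq_transfer.
Qed.

(* The expectation of [f] over the values of [k] neighbouring vertices of an
   antidiagonal in the game stopped after [n] moves. *)
Definition window_exp (n k : nat) (f : seq label -> R) : R :=
  iter n transfer f (nseq (n + k) Open).

Lemma window_expS n k f :
  window_exp n.+1 k f = window_exp n k.+1 (transfer f).
Proof. by rewrite /window_exp iterSr addSnnS. Qed.

Lemma eq_window_exp n k f g : (forall y, size y = k -> f y = g y) ->
  window_exp n k f = window_exp n k g.
Proof.
by move=> fg; apply: (eq_iter_transfer fg); rewrite size_nseq.
Qed.

Lemma window_expP n k a f g : window_exp n k (fun x => a * f x + g x) =
  a * window_exp n k f + window_exp n k g.
Proof. by rewrite /window_exp iter_transferP. Qed.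

Lemma window_expD n k f g :
  window_exp n k (fun x => f x + g x) = window_exp n k f + window_exp n k g.
Proof.
rewrite -[X in _ = X + _]mul1r -window_expP.
by congr (window_exp _ _ _); apply/funext => x; rewrite mul1r.
Qed.

Lemma window_expZ n k c f :
  window_exp n k (fun x => c * f x) = c * window_exp n k f.
Proof.
have -> : (fun x => c * f x) = (fun x => (c - 1) * f x + f x).
  by apply/funext => x; ring.
by rewrite window_expP; ring.
Qed.

Lemma window_exp_label_exp n k m (F : seq label -> seq label -> R) :
  window_exp n k (fun x => label_exp m (F x)) =
  label_exp m (fun l => window_exp n k (F^~ l)).
Proof.
elim: m F => [//|m IH] F /=; rewrite -!IH -!window_expZ -!window_expD.
by congr (window_exp _ _ _); apply/funext.
Qed.

Hypothesis p_ge0 : forall a, 0 <= p a.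
Hypothesis p_sum : p Target + p Trap + p Open = 1.

Lemma label_exp_cst m c : label_exp m (fun=> c) = c.
Proof. by elim: m => //= m ->; rewrite -!mulrDl p_sum mul1r. Qed.

Lemma le_label_exp m F G : (forall l, size l = m -> F l <= G l) ->
  label_exp m F <= label_exp m G.
Proof.
elim: m F G => [|m IH] F G FG /=; first exact: FG.
by rewrite !lerD // ler_wpM2l // IH // => l sl; apply: FG; rewrite /= sl.
Qed.

Lemma le_window_exp n k f g : (forall y, size y = k -> f y <= g y) ->
  window_exp n k f <= window_exp n k g.
Proof.
move=> fg; suff: forall x, size x = (n + k)%N ->
    iter n transfer f x <= iter n transfer g x.
  by apply; rewrite size_nseq.
elim: n => [|n IH] x; first exact: fg.
rewrite addSn !iterS /transfer => sx; rewrite sx.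
by apply: le_label_exp => l sl; apply: IH; exact: size_updates.
Qed.

Lemma window_exp_cst n k c : window_exp n k (fun=> c) = c.
Proof.
elim: n k => [//|n IH] k; rewrite window_expS -[RHS](IH k.+1).
by congr (window_exp _ _ _); apply/funext => x; exact: label_exp_cst.
Qed.

Lemma transfer_cons f a b x : transfer f (a :: b :: x) =
  label_exp 2 (fun l => transfer (fun y =>
    f (best (through (nth Open l 0) a) (through (nth Open l 1) b) :: y))
    (b :: x)).
Proof. by []. Qed.

(** The two labels of the discarded vertex integrate out to 1. *)
Lemma transfer_behead k f x : size x = k.+2 ->
  transfer (fun y => f (behead y)) x = transfer f (behead x).
Proof.
case: x => [|a [|b x]] // _; rewrite transfer_cons.
exact: (label_exp_cst 2 (transfer f (b :: x))).
Qed.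

Lemma transfer_take k f x : size x = k.+2 ->
  transfer (fun y => f (take k y)) x = transfer f (take k.+1 x).
Proof.
elim: k f x => [|k IH] f [|a [|b x]] // sx.
  transitivity (transfer (fun=> f [::]) [:: a, b & x]).
    by apply: (eq_transfer _ sx) => y _; rewrite take0.
  by rewrite /transfer label_exp_cst.
rewrite [take k.+2 _]/= !transfer_cons; apply: eq_label_exp => l _.
exact: (IH _ (b :: x) (succn_inj sx)).
Qed.

(** Together with [window_exp_take], this is translation invariance: the first and the last [k] of
    [k.+1] values have the same law. *)
Lemma window_exp_behead n k f :
  window_exp n k.+1 (fun y => f (behead y)) = window_exp n k f.
Proof.
suff H x : size x = (n + k.+1)%N ->
    iter n transfer (fun y => f (behead y)) x = iter n transfer f (behead x).
  by rewrite /window_exp H ?size_nseq // addnS.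
elim: n x => [//|n IH] x sx; rewrite !iterS.
rewrite (eq_transfer (g := fun y => iter n transfer f (behead y)) _ sx); last exact: IH.
by rewrite (transfer_behead (k := (n + k)%N)) // sx addSn addnS.
Qed.

Lemma window_exp_take n k f :
  window_exp n k.+1 (fun y => f (take k y)) = window_exp n k f.
Proof.
suff H x : size x = (n + k.+1)%N ->
    iter n transfer (fun y => f (take k y)) x = iter n transfer f (take (n + k) x).
  rewrite /window_exp H ?size_nseq // take_nseq //.
  by rewrite addnS.
elim: n x => [//|n IH] x sx; rewrite !iterS.
rewrite (eq_transfer (g := fun y => iter n transfer f (take (n + k) y)) _ sx);
  last exact: IH.
by rewrite (transfer_take (k := (n + k)%N)) // sx addSn addnS.
Qed.

End LabelExpectation.

(** * Random labels *)

Definition antidiag (v : vertex) (i : nat) : vertex := (v.1 + i%:Z, v.2 - i%:Z).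

Definition level (v : vertex) : int := v.1 + v.2.

Definition out_edges (v : vertex) (j k : nat) : seq edge :=
  [seq (antidiag v i, a) | i <- iota j k, a <- [:: true; false]].

Definition window (lab : edge -> label) (n : nat) (v : vertex) (j k : nat) :
  seq label := [seq value lab n (antidiag v i) | i <- iota j k].

Lemma step_antidiag_true v i : step (antidiag v i) true = antidiag (step v true) i.
Proof. by rewrite /antidiag /step /=; congr pair; ring. Qed.

Lemma step_antidiag_false v i :
  step (antidiag v i) false = antidiag (step v true) i.+1.
Proof. by rewrite /antidiag /step /= intS; congr pair; ring. Qed.

Lemma level_antidiag v i : level (antidiag v i) = level v.
Proof. by rewrite /level /antidiag /=; ring. Qed.

Lemma antidiag0 v : antidiag v 0 = v.
Proof. by case: v => x y; rewrite /antidiag /= addr0 subr0. Qed.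

Lemma level_step v : level v < level (step v true).
Proof. by rewrite /level /step /= addrA ltrDl. Qed.

Lemma size_out_edges v j k : size (out_edges v j k) = k.*2.
Proof. by rewrite /out_edges size_allpairs size_iota muln2. Qed.

Lemma out_edges_uniq v j k : uniq (out_edges v j k).
Proof.
apply: allpairs_uniq; rewrite ?iota_uniq //.
by move=> [i a] [i' a'] /= _ _ [/addrI[->] _ ->].
Qed.

Lemma level_out_edges v j k e : e \in out_edges v j k -> level e.1 = level v.
Proof. by move=> /allpairsP[[i a] [_ _ ->]] /=; exact: level_antidiag. Qed.

(* The moves from [antidiag v i] lead to the vertices number [i] (direction
   [true]) and [i.+1] (direction [false]) of the next antidiagonal. *)
Lemma windowS lab n v j k : window lab n.+1 v j k =
  updates (window lab n (step v true) j k.+1) (map lab (out_edges v j k)).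
Proof.
elim: k j => [//|k IH] j.
transitivity (value lab n.+1 (antidiag v j) :: window lab n.+1 v j.+1 k) => //.
by rewrite IH valueS /option_value step_antidiag_true step_antidiag_false.
Qed.

Section RandomWindow.
Context {d : measure_display} {T : measurableType d} {R : realType}.
Variables (P : probability T R) (r s : R) (L : edge -> T -> label).
Hypothesis HL : bond_labels P r s L.

Let labels (w : T) : edge -> label := L^~ w.

Definition label_prob (r s : R) (a : label) : R :=
  match a with Trap => r | Target => s | Open => 1 - r - s end.

(** Measurability for the discrete sigma-algebra on [U]. *)
Let discrete_rv (U : Type) (X : T -> U) : Prop :=
  forall A : set U, measurable (X @^-1` A).

Lemma discrete_rv_comp U V (g : U -> V) (X : T -> U) :
  discrete_rv X -> discrete_rv (g \o X).
Proof. by move=> mX A; exact: (mX (g @^-1` A)). Qed.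

(** The preimage splits into three pieces, one for each value of [Y]. *)
Lemma discrete_rv_pair U (X : T -> U) (Y : T -> label) :
  discrete_rv X -> discrete_rv Y -> discrete_rv (fun w => (X w, Y w)).
Proof.
move=> mX mY A.
pose B a := X @^-1` [set u | A (u, a)] `&` Y @^-1` [set a].
have -> : (fun w => (X w, Y w)) @^-1` A = B Trap `|` (B Target `|` B Open).
  rewrite /B; apply/seteqP; split=> w /=.
    by case E: (Y w); [left|right; left|right; right].
  by case=> [[? ->]|[[? ->]|[? ->]]].
have mB a : measurable (B a) by apply: measurableI; [exact: mX|exact: mY].
by apply: measurableU => //; exact: measurableU.
Qed.

Lemma discrete_rv_map (I : Type) (F : I -> T -> label) (u : seq I) :
  (forall i, discrete_rv (F i)) -> discrete_rv (fun w => map (F^~ w) u).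
Proof.
move=> mF; elim: u => [|i u IH] A.
  have [A0|nA] := pselect (A [::]).
    by rewrite (_ : _ @^-1` _ = setT) //; apply/seteqP; split.
  by rewrite (_ : _ @^-1` _ = set0) //; apply/seteqP; split.
exact: (discrete_rv_comp (fun q => q.2 :: q.1) (discrete_rv_pair IH (mF i))).
Qed.

Lemma discrete_rv_value n v : discrete_rv (fun w => value (labels w) n v).
Proof.
elim: n v => [|n IH] v.
  by apply: (@discrete_rv_comp _ _ (fun=> Open)); exact: (bond_measurable HL (v, true)).
have mL e : discrete_rv (fun w => labels w e).
  exact: (bond_measurable HL e).
exact: (discrete_rv_comp
  (fun q => best (through q.1.2 q.1.1.1) (through q.2 q.1.1.2))
  (discrete_rv_pair (discrete_rv_pair (discrete_rv_pair
    (IH (step v true)) (IH (step v false))) (mL (v, true))) (mL (v, false)))).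
Qed.

Lemma discrete_rv_window n v j k :
  discrete_rv (fun w => window (labels w) n v j k).
Proof.
exact: (discrete_rv_map (F := fun i w => value (labels w) n (antidiag v i)))
  (fun i => discrete_rv_value _ _).
Qed.

Lemma discrete_rv_labels (J : seq edge) :
  discrete_rv (fun w => map (labels w) J).
Proof. exact: (discrete_rv_map (F := L)) (bond_measurable HL). Qed.

Lemma prob_label e a : P (L e @^-1` [set a]) = (label_prob r s a)%:E.
Proof.
by case: a; [exact: (bond_trap HL)|exact: (bond_target HL)|exact: (bond_open HL)].
Qed.

Lemma prob_labels (J : seq edge) (l : seq label) :
  uniq J -> size l = size J ->
  P [set w | map (labels w) J = l] = (\prod_(a <- l) label_prob r s a)%:E.
Proof.
(* Writing [l] as the values on [J] of a function of edges turns the event into an intersection to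
   which independence applies. *)
move=> uJ sl; pose h e := nth Open l (index e J).
have lE : l = map h J.
  apply: (@eq_from_nth _ Open) => [|i il]; first by rewrite size_map.
  rewrite sl in il; case: J uJ sl @h il => // e0 J uJ sl h il.
  by rewrite (nth_map e0) // /h index_uniq.
have -> : [set w | map (labels w) J = l] =
    \bigcap_(e in [set` J]) (L e @^-1` [set h e]).
  apply/seteqP; split=> w /=.
    by rewrite lE => /eq_in_map H e /= /H.
  by move=> H; rewrite lE; apply/eq_in_map => e eJ; exact: (H e eJ).
rewrite (bond_independent HL) // [in RHS]lE big_map -prodEFin.
by apply: eq_bigr => e _; rewrite prob_label.
Qed.

Lemma prob_split_label (A : set T) e : measurable A ->
  P A = (P (A `&` L e @^-1` [set Target]) + P (A `&` L e @^-1` [set Trap])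
         + P (A `&` L e @^-1` [set Open]))%E.
Proof.
move=> mA.
have mB a : measurable (A `&` L e @^-1` [set a]).
  by apply: measurableI => //; exact: (bond_measurable HL).
rewrite -!measureU //; last 3 first.
- exact: measurableU.
- by apply/seteqP; split=> // w [[[_ /= ->]|[_ /= ->]] [_]].
- by apply/seteqP; split=> // w [[_ /= ->] [_]].
congr (P _); apply/seteqP; split=> w /=; last by case=> [[]|]; case.
by move=> Aw; case E: (L e w); [left; right|left; left|right].
Qed.

Lemma prob_label_exp (J : seq edge) (A : set T) (c : R) (q : seq label -> R) :
  measurable A ->
  (forall l, size l = size J -> P (A `&` [set w | map (labels w) J = l]) =
    (c * (\prod_(a <- l) label_prob r s a) * q l)%:E) ->
  P A = (c * label_exp (label_prob r s) (size J) q)%:E.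
Proof.
elim: J A c q => [|e J IH] A c q mA H.
  have := H [::] erefl; rewrite big_nil mulr1 /= => <-.
  by congr (P _); apply/seteqP; split=> w //= -[].
have step a : P (A `&` L e @^-1` [set a]) =
    (c * label_prob r s a
     * label_exp (label_prob r s) (size J) (fun l => q (a :: l)))%:E.
  apply: IH => [|l sl].
    by apply: measurableI => //; exact: (bond_measurable HL).
  rewrite -setIA -(mulrA c) -(big_cons 1 *%R a l xpredT) -H /= ?sl //.
  congr (P (_ `&` _)); apply/seteqP; split=> w /=; by move=> [<- <-].
rewrite (prob_split_label e mA) !step -!EFinD /=; congr EFin; ring.
Qed.

(** The window depends only on edges of level at least [level v], hence is independent of the labels
    on [J]. Carrying [J] along lets the induction absorb into it the edges leaving the current
    antidiagonal. *)
Lemma prob_window n v k (B : pred (seq label)) J l :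
  uniq J -> size l = size J -> {in J, forall e, level e.1 < level v} ->
  P ([set w | B (window (labels w) n v 0 k)] `&` [set w | map (labels w) J = l]) =
  (window_exp (label_prob r s) n k (fun y => (B y)%:R)
   * \prod_(a <- l) label_prob r s a)%:E.
Proof.
elim: n v k B J l => [|n IH] v k B J l uJ sl lJ.
  have wE w : window (labels w) 0 v 0 k = nseq k Open.
    by rewrite /window /= -[k in RHS](size_iota 0); elim: (iota _ _) => //= i u ->.
  rewrite /window_exp /= add0n.
  rewrite (_ : [set w | _] = if B (nseq k Open) then setT else set0); last first.
    by apply/seteqP; split=> w /=; rewrite wE; case: (B _).
  case: (B _); first by rewrite setTI prob_labels // mul1r.
  by rewrite set0I measure0 mul0r.
pose J' := out_edges v 0 k.
rewrite window_expS.
rewrite (@eq_window_exp _ _ _ _ _ (fun x => label_exp (label_prob r s)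
    (size J') (fun l' => (B (updates x l'))%:R))); last first.
  by move=> y sy; rewrite /transfer sy size_out_edges.
rewrite window_exp_label_exp mulrC; apply: prob_label_exp.
  apply: measurableI; last exact: (discrete_rv_labels J [set l]).
  exact: (discrete_rv_window n.+1 v 0 k [set x | B x]).
move=> l' sl'; rewrite -big_cat mulrC.
transitivity (P ([set w | B (updates (window (labels w) n (step v true) 0 k.+1) l')]
    `&` [set w | map (labels w) (J ++ J') = l ++ l'])); last first.
  apply: (IH _ _ (fun x => B (updates x l'))).
  - rewrite cat_uniq uJ out_edges_uniq andbT; apply/hasPn => e eJ'.
    apply/negP => eJ; have := lJ e eJ.
    by rewrite (level_out_edges eJ') ltxx.
  - by rewrite !size_cat sl sl'.
  - have lv := level_step v.
    move=> e; rewrite mem_cat => /orP[/lJ le|/level_out_edges ->] //.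
    exact: lt_trans lv.
congr (P _); apply/seteqP; split=> w /=.
  by rewrite windowS map_cat => -[[Bw <-] <-].
rewrite windowS map_cat => -[Bw E].
have sJ : size (map (labels w) J) = size l by rewrite size_map sl.
move: (congr1 (take (size l)) E) (congr1 (drop (size l)) E).
rewrite take_size_cat // take_size_cat // drop_size_cat // drop_size_cat //.
by move=> <- e'; split=> //; rewrite e'.
Qed.

End RandomWindow.

(** * The drift criterion *)

Definition is_open (a : label) : bool := if a is Open then true else false.

Lemma seq_label_bound (R : realType) k (f : seq label -> R) :
  exists C, forall x, size x = k -> `|f x| <= C.
Proof.
elim: k f => [|k IH] f; first by exists `|f [::]| => -[].
have [C1 H1] := IH (fun x => f (Target :: x)).
have [C2 H2] := IH (fun x => f (Trap :: x)).
have [C3 H3] := IH (fun x => f (Open :: x)).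
exists (Num.max C1 (Num.max C2 C3)) => -[|a x] //= [sx].
by rewrite !le_max; case: a; rewrite ?H1 ?H2 ?H3 ?orbT.
Qed.

Theorem drift_draw_probability_eq0 (R : realType) (r s c : R) (k : nat)
    (f g : seq label -> R) :
  Theta' (r, s) -> 0 < c ->
  (forall x, size x = k.+1 ->
    transfer (label_prob r s) (fun y => f y + g y) x
    + c * (is_open (head Target x))%:R <= f (take k x) + g (behead x)) ->
  draw_probability_eq0 r s.
Proof.
move=> [/= /andP[r0 _] /andP[s0 _] /andP[_ rs1]] c0 drift d T P L v HL.
set p := label_prob r s in drift.
have p_ge0 a : 0 <= p a by case: a => //=; rewrite -addrA -opprD subr_ge0.
have p_sum : p Target + p Trap + p Open = 1 by rewrite /p /=; ring.
pose D n := [set w | value (L^~ w) n v = Open].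
have mD n : measurable (D n) by exact: (discrete_rv_value HL n v [set Open]).
pose u n := window_exp p n k.+1 (fun x => (is_open (head Target x))%:R).
have PD n : P (D n) = (u n)%:E.
  have := @prob_window _ _ _ _ _ _ _ HL n v k.+1
    (fun x => is_open (head Target x)) [::] [::] erefl erefl.
  rewrite big_nil mulr1 => <- //; congr (P _); apply/seteqP; split=> w.
    by rewrite /D /= antidiag0 => ->; split.
  by rewrite /D /= antidiag0; case: (value _ _ _) => -[].
have drawE : [set w | draw (L^~ w) v] = \bigcap_n D n.
  apply/seteqP; split=> w /=.
    by move=> /drawP H n _; exact: H.
  by move=> H; apply/drawP => n; exact: H.
have mdraw : measurable [set w | draw (L^~ w) v].
  by rewrite drawE; exact: bigcapT_measurable.
have le_draw n : (P [set w | draw (L^~ w) v] <= (u n)%:E)%E.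
  rewrite -PD; apply: le_measure; rewrite ?inE //.
  by rewrite drawE; exact: bigcap_inf.
pose Phi n := window_exp p n k (fun y => f y + g y).
(* Translation invariance moves [f] to the first [k] values and [g] to the last [k], where the
   pointwise hypothesis applies. *)
have Phi_step n : Phi n.+1 + c * u n <= Phi n.
  rewrite /Phi window_expS /u -window_expZ -window_expD [leRHS]window_expD.
  rewrite -(window_exp_take p_sum n k f) -(window_exp_behead p_sum n k g).
  by rewrite -window_expD; apply: le_window_exp => // y; exact: drift.
have [C HC] := seq_label_bound k (fun y => f y + g y).
have Phi_ge n : - C <= Phi n.
  rewrite -(window_exp_cst p_sum n k (- C)); apply: le_window_exp => // y sy.
  by have := HC y sy; rewrite ler_norml => /andP[].
have Pfin : P [set w | draw (L^~ w) v] \is a fin_num by exact: fin_num_measure.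
rewrite /draw_probability -(fineK Pfin); set q := fine _.
have q_le n : q <= u n by rewrite -lee_fin /q fineK.
have q0 : 0 <= q by apply: fine_ge0; exact: measure_ge0.
(* As [q <= u n] for all [n], every step costs at least [c * q]; for [q > 0] this would eventually
   break the lower bound [- C]. *)
have sum n : n%:R * (c * q) + Phi n <= Phi 0%N.
  elim: n => [|n IH]; first by rewrite mul0r add0r.
  have := Phi_step n; have : c * q <= c * u n by rewrite ler_pM2l.
  by rewrite mulrSr => *; lra.
congr EFin; apply/eqP; rewrite eq_le q0 andbT leNgt; apply/negP => q_gt0.
have cq : 0 < c * q by exact: mulr_gt0.
have := Num.Theory.archi_boundP (x := `|(Phi 0%N + C) / (c * q)|) (normr_ge0 _).
set N := Num.bound _ => hN.
have : (Phi 0%N + C) / (c * q) < N%:R by apply: le_lt_trans hN; exact: ler_norm.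
rewrite ltr_pdivrMr // => lt.
have := sum N; have := Phi_ge N; lra.
Qed.

(** * Certificates of decrease *)

Section CoefficientList.
Variables (C : Type) (zero : C) (add mul : C -> C -> C).

(** The operations on [C] are parameters because the construction is nested: polynomials in [t] over
    [Z], then polynomials in [y] over those. *)
Fixpoint padd (p q : seq C) : seq C :=
  match p, q with
  | a :: p', b :: q' => add a b :: padd p' q'
  | [::], _ => q
  | _, [::] => p
  end.

Fixpoint pmul (p q : seq C) : seq C :=
  if p is a :: p' then padd (map (mul a) q) (zero :: pmul p' q) else [::].

Variables (R : comNzRingType) (ev : C -> R) (t : R).

Fixpoint peval (p : seq C) : R := if p is a :: p' then ev a + t * peval p' else 0.

Hypothesis ev0 : ev zero = 0.
Hypothesis evD : forall a b, ev (add a b) = ev a + ev b.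
Hypothesis evM : forall a b, ev (mul a b) = ev a * ev b.

Lemma pevalD p q : peval (padd p q) = peval p + peval q.
Proof.
elim: p q => [|a p IH] [|b q] /=; rewrite ?add0r ?addr0 //.
by rewrite evD IH; ring.
Qed.

Lemma pevalM p q : peval (pmul p q) = peval p * peval q.
Proof.
elim: p => [|a p IH] /=; first by rewrite mul0r.
rewrite pevalD /= ev0 add0r IH mulrDl mulrA; congr (_ + _).
by elim: q {IH} => [|b q IH] /=; rewrite ?mulr0 // evM IH; ring.
Qed.

End CoefficientList.

(* Binary coefficients, unlike [int], keep the checks below fast. *)
Definition bipoly : Type := seq (seq Z).

Definition badd : bipoly -> bipoly -> bipoly := padd (padd +%R).
Definition bmul : bipoly -> bipoly -> bipoly :=
  pmul [::] (padd +%R) (pmul 0 +%R *%R).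
Definition bcst (p : seq Z) : bipoly := [:: p].
Definition bsub (p q : bipoly) : bipoly := badd p (bmul (bcst [:: -1]) q).
Definition bexp (p : bipoly) (n : nat) : bipoly := iter n (bmul p) (bcst [:: 1]).

(** Suffices for nonnegativity on the quadrant [t, y >= 0], which is why parameter ranges are mapped
    there. *)
Definition bnonneg (p : bipoly) : bool := all (all (Z.leb 0)) p.

Section Evaluation.
Variables (R : realType) (t y : R).

Definition zeval (z : Z) : R := (int_of_Z z)%:~R.

Definition ueval (p : seq Z) : R := peval zeval t p.
Definition beval (p : bipoly) : R := peval ueval y p.

Lemma zevalD a b : zeval (a + b) = zeval a + zeval b.
Proof. by rewrite /zeval !rmorphD. Qed.

Lemma zevalM a b : zeval (a * b) = zeval a * zeval b.
Proof. by rewrite /zeval !rmorphM. Qed.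

Lemma zeval0 : zeval 0 = 0. Proof. by []. Qed.
Lemma zeval1 : zeval 1 = 1. Proof. by []. Qed.

Lemma uevalD p q : ueval (padd +%R p q) = ueval p + ueval q.
Proof. exact: (pevalD _ zevalD). Qed.

Lemma uevalM p q : ueval (pmul 0 +%R *%R p q) = ueval p * ueval q.
Proof. exact: (pevalM _ zeval0 zevalD zevalM). Qed.

Lemma bevalD p q : beval (badd p q) = beval p + beval q.
Proof. exact: (pevalD _ uevalD). Qed.

Lemma bevalM p q : beval (bmul p q) = beval p * beval q.
Proof. exact: (pevalM _ (erefl : ueval [::] = 0) uevalD uevalM). Qed.

Lemma beval_cst p : beval (bcst p) = ueval p.
Proof. by rewrite /beval /= mulr0 addr0. Qed.

Lemma bevalB p q : beval (bsub p q) = beval p - beval q.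
Proof.
rewrite bevalD bevalM beval_cst /ueval /= mulr0 addr0.
by rewrite /zeval rmorphN rmorph1 rmorphN1 mulN1r.
Qed.

Lemma bevalX p n : beval (bexp p n) = beval p ^+ n.
Proof.
elim: n => [|n IH]; last by rewrite exprS -IH -bevalM.
by rewrite beval_cst /ueval /= mulr0 addr0.
Qed.

Lemma beval_ge0 p : 0 <= t -> 0 <= y -> bnonneg p -> 0 <= beval p.
Proof.
move=> t0 y0; elim: p => [//|q p IH] /= /andP[hq hp].
apply: addr_ge0; last by rewrite mulr_ge0 // IH.
elim: q hq {IH} => [//|a q IH] /= /andP[ha hq].
apply: addr_ge0; last by rewrite mulr_ge0 // IH.
by rewrite /zeval ler0z; lia.
Qed.

End Evaluation.

Fixpoint label_bipoly (w : label -> bipoly) (m : nat) (F : seq label -> bipoly) :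
    bipoly :=
  if m is m'.+1 then
    badd (badd
      (bmul (w Target) (label_bipoly w m' (fun l => F (Target :: l))))
      (bmul (w Trap) (label_bipoly w m' (fun l => F (Trap :: l)))))
      (bmul (w Open) (label_bipoly w m' (fun l => F (Open :: l))))
  else F [::].

(** Each of the [m] labels contributes one factor [k], the common denominator. *)
Lemma beval_label_bipoly (R : realType) (t y k : R) w m F (p : label -> R) :
  (forall a, beval t y (w a) = k * p a) ->
  beval t y (label_bipoly w m F) =
  k ^+ m * label_exp p m (fun l => beval t y (F l)).
Proof.
move=> wE; elim: m F => [|m IH] F /=; first by rewrite mul1r.
by rewrite !bevalD !bevalM !wE !IH exprS; ring.
Qed.

Fixpoint all_labels (k : nat) (B : pred (seq label)) : bool :=
  if k is k'.+1 then
    [&& all_labels k' (fun x => B (Target :: x)),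
        all_labels k' (fun x => B (Trap :: x)) &
        all_labels k' (fun x => B (Open :: x))]
  else B [::].

Lemma all_labelsP k B : all_labels k B -> forall x, size x = k -> B x.
Proof.
elim: k B => [|k IH] B /=; first by move=> ? [].
by move=> /and3P[h1 h2 h3] [//|[] x] [sx];
  [exact: (IH _ h2)|exact: (IH _ h1)|exact: (IH _ h3)].
Qed.

Section DriftCheck.
Variables (total target trap cost : bipoly) (f : seq label -> bipoly).

Definition label_weight (a : label) : bipoly :=
  match a with
  | Trap => trap
  | Target => target
  | Open => bsub (bsub total trap) target
  end.

Definition pair_potential (x : seq label) : bipoly := badd (f x) (f (rev x)).

(* The probabilities of the labels have the common denominator [total]; the
   drift inequality is multiplied by its power that clears denominators. *)
Definition drift_bipoly (x : seq label) : bipoly :=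
  let bound := badd (f (take (size x).-1 x)) (f (rev (behead x))) in
  bsub (bmul (bexp total (size x).-1.*2)
         (if is_open (head Target x) then bsub bound cost else bound))
       (label_bipoly label_weight (size x).-1.*2
         (fun l => pair_potential (updates x l))).

Definition drift_check (k : nat) : bool :=
  all_labels k (fun x => bnonneg (drift_bipoly x)).

Lemma drift_check_draw_probability_eq0 (R : realType) (k : nat) (r s t y : R) :
  Theta' (r, s) -> drift_check k.+1 -> 0 <= t -> 0 <= y ->
  0 < beval t y total -> 0 < beval t y cost ->
  beval t y trap = beval t y total * r ->
  beval t y target = beval t y total * s ->
  draw_probability_eq0 r s.
Proof.
move=> rs chk t0 y0; set K := beval t y total => K0 cost0 trapE targetE.
apply: (@drift_draw_probability_eq0 R r s (beval t y cost) k
  (fun x => beval t y (f x)) (fun x => beval t y (f (rev x)))) => // x sx.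
have := beval_ge0 t0 y0 (all_labelsP chk sx).
have wE a : beval t y (label_weight a) = K * label_prob r s a.
  by case: a; rewrite //= !bevalB -/K trapE targetE; ring.
rewrite /drift_bipoly bevalB bevalM bevalX -/K (beval_label_bipoly _ _ wE).
rewrite -mulrBr pmulr_rge0 ?exprn_gt0 // subr_ge0.
rewrite /transfer sx /= => h.
rewrite -lerBrDr; apply: le_trans (_ : label_exp _ _ _ <= _).
  by rewrite le_eqVlt; apply/orP; left; apply/eqP/eq_label_exp => l _; rewrite -bevalD.
apply: le_trans h _.
by case: is_open; rewrite ?bevalB bevalD ?mulr1 ?mulr0 ?subr0.
Qed.

End DriftCheck.

(** * Potentials *)

Local Delimit Scope Z_scope with BZ.

Lemma beval_nil (R : realType) (t y : R) : beval t y [::] = 0.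
Proof. by []. Qed.

Lemma beval_cons (R : realType) (t y : R) p q :
  beval t y (p :: q) = ueval t p + y * beval t y q.
Proof. by []. Qed.

Lemma ueval_nil (R : realType) (t : R) : ueval t [::] = 0.
Proof. by []. Qed.

Lemma ueval_cons (R : realType) (t : R) a p :
  ueval t (a :: p) = zeval R a + t * ueval t p.
Proof. by []. Qed.

Lemma zeval_literals (R : realType) :
  (zeval R 4%BZ = 4) * (zeval R 100%BZ = 100) * (zeval R 108%BZ = 108)
  * (zeval R 157%BZ = 157) * (zeval R 220%BZ = 220) * (zeval R 500%BZ = 500)
  * (zeval R 1000%BZ = 1000).
Proof. by []. Qed.

Definition bevalE := (bevalM, bevalD, beval_cst, beval_cons, beval_nil,
  ueval_cons, ueval_nil, zeval_literals, zeval0, zeval1).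

(* The weights of the 27 windows of length 3, read as numbers in base 3 with
   the digits Target = 0, Trap = 1 and Open = 2. *)
Definition table (weights : seq Z) (x : seq label) : Z :=
  nth 0 weights (foldl (fun n a => 3 * n +
    match a with Target => 0 | Trap => 1 | Open => 2 end)%N 0%N x).

(* With [s = t / (1 + 100 t)] and [r / s ^+ 2 = 4 y / (1 + y)], everything below
   is multiplied by [(1 + 100 t) ^+ 2], and [total], [target] and [trap] by
   [1 + y] as well. *)
Definition rare_trap_unit : bipoly := bcst [:: 1; 100]%BZ.

Definition rare_trap_total : bipoly :=
  bmul (bmul rare_trap_unit rare_trap_unit) [:: [:: 1]; [:: 1]]%BZ.

Definition rare_trap_target : bipoly :=
  bmul (bmul (bcst [:: 0; 1]%BZ) rare_trap_unit) [:: [:: 1]; [:: 1]]%BZ.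

Definition rare_trap_trap : bipoly := [:: [::]; [:: 0; 0; 4]]%BZ.

Definition rare_trap_potential (x : seq label) : bipoly :=
  badd (bmul (bcst [:: table
    [:: 0; 0; 1; 0; 0; 0; 1; 1; 1;
        0; 0; 1; 0; 0; 0; 1; 0; 1;
        0; 1; 1; 0; 0; 0; 1; 1; 1]%BZ x])
    (bmul rare_trap_unit rare_trap_unit))
  (badd (bmul (bcst [:: 0; table
    [:: 0; 0; -2; 0; 0; 0; 0; 0; -2;
        0; 0; -4; 0; 0; 0; 0; 0; -2;
        4; 0; -4; 0; 0; 0; 0; 0; -2]%BZ x]) rare_trap_unit)
  (bcst [:: 0; 0; table
    [:: 0; 0; -9; 0; 0; 4; -1; -10; -10;
        0; 0; 1; 0; 0; 4; 1; 10; 10;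
        -10; -10; 10; 10; 6; 8; -1; -10; -10]%BZ x])).

(** The decrease [t ^ 2] of the scaled weights is a decrease [s ^ 2] of the weights themselves,
    positive for each fixed [s > 0]. *)
Lemma rare_trap_check : drift_check rare_trap_total rare_trap_target
  rare_trap_trap (bcst [:: 0; 0; 1]%BZ) rare_trap_potential 4.
Proof. by vm_cast_no_check (erefl true). Qed.

Lemma rare_trap_draw_probability_eq0 (R : realType) (r s : R) :
  Theta' (r, s) -> 0 < s -> 100 * s < 1 -> r < 4 * s ^+ 2 ->
  draw_probability_eq0 r s.
Proof.
move=> rs s0 s1 r4; have r0 : 0 <= r by case: rs => /andP[].
have s2 : 0 < s ^+ 2 by exact: exprn_gt0.
have d1 : 0 < 1 - 100 * s by lra.
have d2 : 0 < 4 * s ^+ 2 - r by lra.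
apply: (drift_check_draw_probability_eq0 (t := s / (1 - 100 * s))
    (y := r / (4 * s ^+ 2 - r)) rs rare_trap_check).
- by rewrite divr_ge0 // ltW.
- by rewrite divr_ge0 // ltW.
- rewrite !bevalE !mulr0 !addr0 !mulr1.
  have -> : 1 + s / (1 - 100 * s) * 100 = (1 - 100 * s)^-1 by field; lra.
  have -> : 1 + r / (4 * s ^+ 2 - r) = 4 * s ^+ 2 / (4 * s ^+ 2 - r) by field; lra.
  by rewrite !(mulr_gt0, divr_gt0, invr_gt0).
- by rewrite !bevalE !mulr0 !addr0 !add0r !mulr1 mulr_gt0 ?divr_gt0.
- by rewrite !bevalE; field; lra.
- by rewrite !bevalE; field; lra.
Qed.

(* From here on the parameter [x] in the interval from [lo] to [hi] is
   [(hi + lo t) / (1 + t)], in thousandths. *)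
Definition few_trap_potential (x : seq label) : bipoly := bcst [:: table
  [:: 0; 0; 139; 0; 0; 68; 181; 171; 190;
      0; 0; 148; 0; 0; 55; 159; 43; 182;
      101; 200; 177; 52; 46; 87; 194; 200; 198]%BZ x].

Definition many_trap_potential (x : seq label) : bipoly := bcst [:: table
  [:: 0; 0; 31; 0; 0; 15; 46; 42; 47;
      0; 0; 33; 0; 0; 12; 40; 25; 45;
      26; 44; 41; 17; 18; 22; 50; 50; 50]%BZ x].

Definition balanced_potential (x : seq label) : bipoly := bcst [:: table
  [:: 0; 0; 10; 0; 0; 4; 14; 13; 15;
      0; 0; 11; 0; 0; 3; 11; 5; 13;
      9; 15; 14; 4; 4; 5; 15; 15; 15]%BZ x].

Lemma few_trap_check : drift_check (bcst [:: 1000; 1000]%BZ) [::]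
  (bcst [:: 220; 157]%BZ) (bcst [:: 1]%BZ) few_trap_potential 4.
Proof. by vm_cast_no_check (erefl true). Qed.

Lemma many_trap_check : drift_check (bcst [:: 1000; 1000]%BZ) [::]
  (bcst [:: 1000; 220]%BZ) (bcst [:: 1]%BZ) many_trap_potential 4.
Proof. by vm_cast_no_check (erefl true). Qed.

Lemma balanced_check : drift_check (bcst [:: 1000; 1000]%BZ)
  (bcst [:: 500; 108]%BZ) (bcst [:: 500; 108]%BZ) (bcst [:: 1]%BZ) balanced_potential 4.
Proof. by vm_cast_no_check (erefl true). Qed.

(** * The draw probability *)

Lemma segment_parameter (R : realType) (lo hi x : R) : lo < x <= hi ->
  exists2 t, 0 <= t & hi + t * lo = (1 + t) * x.
Proof.
move=> /andP[lox xhi]; have d0 : 0 < x - lo by rewrite subr_gt0.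
(* [hi] is reached at [t = 0], while [lo] would need [t] infinite and is therefore excluded. *)
exists ((hi - x) / (x - lo)); first by rewrite divr_ge0 ?subr_ge0 // ltW.
by field; lra.
Qed.

Lemma few_trap_draw_probability_eq0 (R : realType) (r : R) :
  Theta' (r, 0) -> 157 < 1000 * r <= 220 -> draw_probability_eq0 r 0.
Proof.
move=> rs /segment_parameter[t t0 tE].
apply: (drift_check_draw_probability_eq0 rs few_trap_check t0 (lexx 0));
  rewrite !bevalE ?mulr0 ?addr0 ?tE; lra.
Qed.

Lemma many_trap_draw_probability_eq0 (R : realType) (r : R) :
  Theta' (r, 0) -> 220 < 1000 * r <= 1000 -> draw_probability_eq0 r 0.
Proof.
move=> rs /segment_parameter[t t0 tE].
apply: (drift_check_draw_probability_eq0 rs many_trap_check t0 (lexx 0));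
  rewrite !bevalE ?mulr0 ?addr0 ?tE; lra.
Qed.

Lemma balanced_draw_probability_eq0 (R : realType) (s : R) :
  Theta' (s, s) -> 108 < 1000 * s <= 500 -> draw_probability_eq0 s s.
Proof.
move=> rs /segment_parameter[t t0 tE].
apply: (drift_check_draw_probability_eq0 rs balanced_check t0 (lexx 0));
  rewrite !bevalE ?mulr0 ?addr0 ?tE; lra.
Qed.

(** To leading order the hypothesis reads [2 r <= 6 s ^ 2]. The constant 7/2 exceeds 3 to absorb the
    corrections, and stays below the 4 of the certificate. *)
Lemma rare_trap_bound (R : realType) (r s : R) :
  0 <= r <= 1 / 1000 -> 0 <= s <= 1 / 1000 ->
  2 * r / (1 - s)
    + 9 * (2 * s - s ^+ 2) ^+ 3 / 2
    + 16 * (2 * s - s ^+ 2) ^+ 2 * r / (1 - s)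
    + 43 * (2 * s - s ^+ 2) * r ^+ 2 / (2 * (1 - s) ^+ 2)
    + 5 * r ^+ 3 / (1 - s) ^+ 3 <=
  3 * (2 * s - s ^+ 2) ^+ 2 / 2
    + 8 * (2 * s - s ^+ 2) * r / (1 - s)
    + 11 * r ^+ 2 / (2 * (1 - s) ^+ 2) ->
  r <= 7 / 2 * s ^+ 2.
Proof.
move=> /andP[r0 r1] /andP[s0 s1].
(* [p] is the probability that one of two edges is a target, [q] that of a trap given no target. *)
set p := 2 * s - s ^+ 2; set q := r / (1 - s).
have d0 : 0 < 1 - s by lra.
have rE : r = q * (1 - s) by rewrite /q mulfVK //; lra.
have q0 : 0 <= q by rewrite divr_ge0 // ltW.
have p0 : 0 <= p by rewrite /p; nra.
have p_le : p <= 2 * s by rewrite /p; nra.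
have q_le : q <= 1 / 500 by rewrite ler_pdivrMr //; nra.
have -> : 2 * r / (1 - s) = 2 * q by rewrite /q mulrA.
have -> : 16 * p ^+ 2 * r / (1 - s) = 16 * p ^+ 2 * q by rewrite /q mulrA.
have -> : 43 * p * r ^+ 2 / (2 * (1 - s) ^+ 2) = 43 / 2 * p * q ^+ 2.
  by rewrite /q; field; lra.
have -> : 5 * r ^+ 3 / (1 - s) ^+ 3 = 5 * q ^+ 3 by rewrite /q; field; lra.
have -> : 8 * p * r / (1 - s) = 8 * p * q by rewrite /q mulrA.
have -> : 11 * r ^+ 2 / (2 * (1 - s) ^+ 2) = 11 / 2 * q ^+ 2.
  by rewrite /q; field; lra.
move=> h.
(* The cubic terms are dropped, [p * q] and [q ^+ 2] are small multiples of [q], and [p ^+ 2] gives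
   the main term. *)
have n1 : 0 <= p ^+ 3 by exact: exprn_ge0.
have n2 : 0 <= p ^+ 2 * q by rewrite mulr_ge0 ?exprn_ge0.
have n3 : 0 <= p * q ^+ 2 by rewrite mulr_ge0 ?exprn_ge0.
have n4 : 0 <= q ^+ 3 by exact: exprn_ge0.
have m1 : p * q <= 1 / 500 * q by rewrite ler_wpM2r //; lra.
have m2 : q ^+ 2 <= 1 / 500 * q by rewrite expr2 ler_wpM2r.
have m3 : p ^+ 2 <= 4 * s ^+ 2.
  by rewrite (_ : 4 * s ^+ 2 = (2 * s) ^+ 2) ?lerXn2r ?nnegrE //; [lra|ring].
have rq : r <= q by rewrite [leLHS]rE; nra.
lra.
Qed.

Theorem theorem2 (R : realType) :
  [/\ (* B1 *)
      exists e1 e2 : R,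
        [/\ 0 < e1 < 1, 0 < e2 < 1 &
          forall r s : R, Theta' (r, s) -> r <= e1 -> s <= e2 ->
            3 * (2 * s - s ^+ 2) ^+ 2 / 2
              + 8 * (2 * s - s ^+ 2) * r / (1 - s)
              + 11 * r ^+ 2 / (2 * (1 - s) ^+ 2)
            >= 2 * r / (1 - s)
              + 9 * (2 * s - s ^+ 2) ^+ 3 / 2
              + 16 * (2 * s - s ^+ 2) ^+ 2 * r / (1 - s)
              + 43 * (2 * s - s ^+ 2) * r ^+ 2 / (2 * (1 - s) ^+ 2)
              + 5 * r ^+ 3 / (1 - s) ^+ 3 ->
            draw_probability_eq0 r s],
      (* B2: 0.157175 = 0.157 + 0.000175 *)
      forall r s : R, Theta' (r, s) -> s = 0 -> r > 157 / 10 ^+ 3 + 175 / 10 ^+ 6 ->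
        draw_probability_eq0 r s
    & (* B3: 0.10883 = 0.108 + 0.00083 *)
      forall r s : R, Theta' (r, s) -> r = s -> s >= 108 / 10 ^+ 3 + 83 / 10 ^+ 5 ->
        draw_probability_eq0 r s].
Proof.
split.
(* Small enough for [rare_trap_bound] and for [100 * s < 1]. *)
- exists (1 / 1000), (1 / 1000); split; [lra|lra|].
  move=> r s rs r1 s1 h.
  have [/= /andP[r0 _] /andP[s0 _] /andP[rs0 _]] := rs.
  have r_le : r <= 7 / 2 * s ^+ 2.
    by apply: rare_trap_bound h; rewrite ?r0 ?s0.
  (* [s = 0] would force [r = 0], against [0 < r + s]. *)
  have s_gt0 : 0 < s.
    rewrite lt_neqAle s0 andbT; apply/eqP => se.
    by move: r_le; rewrite -se expr0n mulr0 => ?; lra.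
  have s2 : 0 < s ^+ 2 by exact: exprn_gt0.
  apply: rare_trap_draw_probability_eq0 => //; lra.
- move=> r s rs se; subst s => r_gt.
  have [/= /andP[_ r1] _ _] := rs.
  have r157 : 157 < 1000 * r by lra.
  (* Two tables of weights share the range of [r], split at 0.22. *)
  have [r220|r220] := leP (1000 * r) 220.
    by apply: few_trap_draw_probability_eq0; rewrite // r157.
  apply: many_trap_draw_probability_eq0; rewrite // r220; lra.
- move=> r s rs re; subst r => s_ge.
  have [/= _ _ /andP[_ s1]] := rs.
  apply: balanced_draw_probability_eq0 => //; apply/andP; split; lra.
Qed.
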